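(* For a positive integer $n$, let $A(n)$ denote the number of partitions of $n$ into parts $\equiv \pm 2,\pm 3 \pmod 7$. Let $B(n)$ denote the number of bipartitions $(\pi,\lambda)$ of $n$, where $\pi$ is a partition into distinct even parts greater than $2$ with a gap of at least $4$ between consecutive parts, and $\lambda$ is a partition into distinct parts greater than $1$ such that if $e_j$ is the $j$-th part in $\pi$ (where the parts are ordered in ascending order), then the parts $e_j/2$, $e_j/2+1$ and $e_j/2+2$ are not present in $\lambda$. Let $C(n)$ denote the number of bipartitions $(\pi,\mu)$ of $n$, where $\pi$ is a partition into distinct even parts greater than $2$ with a gap of at least $4$ between consecutive parts, and $\mu$ is a partition into distinct parts greater than $1$ such that if $e_j$ is the $j$-th part in $\pi$ (where the parts are ordered in ascending order), then the parts $e_j/2+j-1$, $e_j/2+j$ and $e_j/2+j+1$ are not present in $\mu$. Then $A(n)=B(n)=C(n)$ for every positive integer $n$.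
   Context: The union $\pi\cup\lambda$ of partitions $\pi$ and $\lambda$ is the partition whose parts are those of $\pi$ and $\lambda$ together (with multiplicity), arranged in non-increasing order. A bipartition of a positive integer $n$ is an ordered pair of partitions $(\pi,\lambda)$ such that $\pi\cup\lambda$ is a partition of $n$; $\pi$ or $\lambda$ may be empty. The exclusion conditions are imposed for every part $e_j$ of $\pi$, where $e_1<e_2<\cdots$ are the parts of $\pi$. *)

(* Defs.v *)
From mathcomp Require Import all_boot.

Set Implicit Arguments.
Unset Strict Implicit.
Unset Printing Implicit Defensive.

Definition is_partition (s : seq nat) : bool := sorted geq s && (0 \notin s).

Definition is_partition_of (n : nat) (s : seq nat) : bool :=
  is_partition s && (sumn s == n).

Definition union_partition (s t : seq nat) : seq nat := sort geq (s ++ t).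

Definition is_bipartition_of (n : nat) (s t : seq nat) : bool :=
  [&& is_partition s, is_partition t & is_partition_of n (union_partition s t)].

(* The [j]-th part in ascending order, for [1 <= j <= size s]. *)
Definition asc_part (s : seq nat) (j : nat) : nat := nth 0 (rev s) j.-1.

Definition even_gap4 (s : seq nat) : bool :=
  all (fun e => ~~ odd e && (2 < e)) s
  && sorted (fun a b => a + 4 <= b) (rev s).

Definition distinct_gt1 (s : seq nat) : bool :=
  uniq s && all (fun m => 1 < m) s.

(* The last two congruences are [m = -2] and [m = -3] modulo 7. *)
Definition pm2_pm3_mod7 (m : nat) : bool :=
  [|| m == 2 %[mod 7], m == 3 %[mod 7],
      m + 2 == 0 %[mod 7] | m + 3 == 0 %[mod 7]].

Definition A_part (n : nat) (s : seq nat) : bool :=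
  is_partition_of n s && all pm2_pm3_mod7 s.

Definition B_excluded (p l : seq nat) : bool :=
  all (fun j => let h := asc_part p j %/ 2 in
         [&& h \notin l, h + 1 \notin l & h + 2 \notin l])
      (iota 1 (size p)).

Definition C_excluded (p m : seq nat) : bool :=
  all (fun j => let h := asc_part p j %/ 2 in
         [&& h + j - 1 \notin m, h + j \notin m & h + j + 1 \notin m])
      (iota 1 (size p)).

Definition B_bipart (n : nat) (p l : seq nat) : bool :=
  [&& is_bipartition_of n p l, even_gap4 p, distinct_gt1 l & B_excluded p l].

Definition C_bipart (n : nat) (p m : seq nat) : bool :=
  [&& is_bipartition_of n p m, even_gap4 p, distinct_gt1 m & C_excluded p m].

(* A partition of [n], and each component of a bipartition of [n], has at most
   [n] parts, all at most [n].  Hence counting over the finite type [bparts n]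
   counts all of them, once each: see [parts_inj], [parts_of_partition] and
   [parts_of_bipartition]. *)
Definition bparts (n : nat) := n.-bseq 'I_n.+1.

Definition parts (n : nat) (x : bparts n) : seq nat := [seq val i | i <- x].

Lemma parts_inj n : injective (@parts n).
Proof. by move=> x y /(inj_map val_inj)/val_inj. Qed.

Lemma bounded_parts n s : 0 \notin s -> sumn s <= n ->
  exists x : bparts n, parts x = s.
Proof.
move=> s0 sn.
have szs : size s <= n.
  apply: leq_trans sn; elim: s s0 => //= a s IHs.
  rewrite inE negb_or eq_sym -lt0n => /andP[a0 /IHs h].
  by rewrite -add1n leq_add.
have les : {in s, forall a, a < n.+1}.
  move=> a /= a_s; rewrite ltnS; apply: leq_trans sn.
  elim: s a_s {s0 szs} => //= b s IHs; rewrite inE.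
  case/predU1P=> [->|/IHs h]; first exact: leq_addr.
  exact: leq_trans h (leq_addl _ _).
have szt : size [seq inord a : 'I_n.+1 | a <- s] <= n by rewrite size_map.
exists (Bseq szt); rewrite /parts /= -map_comp.
by rewrite -[RHS]map_id; apply/eq_in_map => a /les /inordK.
Qed.

Lemma parts_of_partition n s : is_partition_of n s ->
  exists x : bparts n, parts x = s.
Proof.
by case/andP=> /andP[_ s0] /eqP sn; apply: bounded_parts; rewrite ?sn.
Qed.

Lemma parts_of_bipartition n s t : is_bipartition_of n s t ->
  exists x y : bparts n, parts x = s /\ parts y = t.
Proof.
case/and3P=> /andP[_ s0] /andP[_ t0] /andP[_ /eqP].
rewrite (perm_sumn (permEl (perm_sort _ _))) sumn_cat => <-.
have [x xs] := bounded_parts s0 (leq_addr (sumn t) (sumn s)).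
by have [y yt] := bounded_parts t0 (leq_addl (sumn s) (sumn t)); exists x, y.
Qed.

Definition A (n : nat) : nat := #|[set x : bparts n | A_part n (parts x)]|.

Definition B (n : nat) : nat :=
  #|[set x : bparts n * bparts n | B_bipart n (parts x.1) (parts x.2)]|.

Definition C (n : nat) : nat :=
  #|[set x : bparts n * bparts n | C_bipart n (parts x.1) (parts x.2)]|.

(* Main.v *)
Require Import Defs.
From mathcomp Require Import all_boot all_algebra zify ring.

(* Let [q] be the formal variable and compare power series modulo [q^N].  Put
   [pi = 2h].  Reading [(h, lambda)] from its smallest parts upwards, the series
   [B_m] of the pairs counted by [B] with all parts of [h] and [lambda] above
   [m] satisfies, with [B'_m = B_m - q^(m+1) B_(m+1)],
     [B'_m = B_(m+1) + q^(2m+2) B'_(m+2)],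
   and these relations determine it.  For [C] one obtains a recurrence in two
   indices; a contiguous relation derived from it shows that its diagonal obeys
   the same recurrence as [B_m].  The products [(q)_oo B_m] are Andrews' series
     [K_i(m) = sum_n (-1)^n q^(3mn + 7n(n+1)/2 - in) (1 - q^(i(m+2n+1)))
               (1 - q^(n+1)) ... (1 - q^(n+m))]
   with [i = 3], because
     [K_i(m) - K_(i-1)(m) = q^((m+1)(i-1)) K_(4-i)(m+1)].
   Finally [(q)_oo B_1 = K_3(1) = K_1(0)] is the theta series of the product of
   the [1 - q^j] with [j = 0, 1, -1 mod 7], by the Jacobi triple product. *)

Set Implicit Arguments.
Unset Strict Implicit.
Unset Printing Implicit Defensive.

Import GRing.Theory.
Local Open Scope ring_scope.

(** * Congruence of polynomials modulo a power of the variable *)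

Definition eqm (N : nat) (p q : {poly int}) := exists r, p = q + 'X^N * r.

Lemma eqm_refl N p : eqm N p p.
Proof. by exists 0; rewrite mulr0 addr0. Qed.

Lemma eqm0 p q : eqm 0 p q.
Proof. by exists (p - q); ring. Qed.

Lemma eqm_sym N p q : eqm N p q -> eqm N q p.
Proof. by case=> r ->; exists (- r); ring. Qed.

Lemma eqm_trans N q p r : eqm N p q -> eqm N q r -> eqm N p r.
Proof. by case=> s -> [t ->]; exists (s + t); ring. Qed.

Lemma eqmD N p p' q q' : eqm N p p' -> eqm N q q' -> eqm N (p + q) (p' + q').
Proof. by case=> s -> [t ->]; exists (s + t); ring. Qed.

Lemma eqmB N p p' q q' : eqm N p p' -> eqm N q q' -> eqm N (p - q) (p' - q').
Proof. by case=> s -> [t ->]; exists (s - t); ring. Qed.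

Lemma eqmM N p p' q q' : eqm N p p' -> eqm N q q' -> eqm N (p * q) (p' * q').
Proof. by case=> s -> [t ->]; exists (s * q' + p' * t + 'X^N * s * t);
  ring. Qed.

Lemma eqmMl N p q q' : eqm N q q' -> eqm N (p * q) (p * q').
Proof. exact/eqmM/eqm_refl. Qed.

Lemma eqm_le M N p q : (N <= M)%N -> eqm M p q -> eqm N p q.
Proof.
by move=> /subnKC <- [r ->]; exists ('X^(M - N) * r); rewrite exprD mulrA.
Qed.

Lemma eqmXnM N k e p q : (N <= e + k)%N -> eqm k p q ->
  eqm N ('X^e * p) ('X^e * q).
Proof.
move=> le [r ->]; apply: (eqm_le le).
by exists r; rewrite exprD; ring.
Qed.

Lemma eqmXn0 N e p : (N <= e)%N -> eqm N (p * 'X^e) 0.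
Proof.
by move=> le; apply: (eqm_le le); exists p; rewrite add0r mulrC.
Qed.

Lemma eqm_sum N (I : eqType) (s : seq I) (F G : I -> {poly int}) :
  {in s, forall i, eqm N (F i) (G i)} ->
  eqm N (\sum_(i <- s) F i) (\sum_(i <- s) G i).
Proof.
elim: s => [|i s IHs] h; first by rewrite !big_nil; apply: eqm_refl.
rewrite !big_cons; apply: eqmD; first by apply: h; rewrite mem_head.
by apply: IHs => j js; apply: h; rewrite in_cons js orbT.
Qed.

Lemma eqm_sum0 N (I : eqType) (s : seq I) (F : I -> {poly int}) :
  {in s, forall i, eqm N (F i) 0} -> eqm N (\sum_(i <- s) F i) 0.
Proof. by move/eqm_sum; rewrite [in X in eqm _ _ X]big1. Qed.

Lemma eqm_coef N p q i : eqm N p q -> (i < N)%N -> p`_i = q`_i.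
Proof. by case=> r -> lt; rewrite coefD coefXnM lt addr0. Qed.

(** A constant term 1 makes [c] invertible as a power series. Here one factor ['X] at a time is
    taken out of [p - q]: [c * s = 'X * r] forces [s] to have constant term 0. *)
Lemma eqm_cancel N (c p q : {poly int}) :
  c`_0 = 1 -> eqm N (c * p) (c * q) -> eqm N p q.
Proof.
move=> c0 [r]; rewrite -[c * p](subrK (c * q)) addrC -mulrBr => /addrI.
suff h : c * (p - q) = 'X^N * r -> exists s, p - q = 'X^N * s.
  by move=> /h [s e]; exists s; rewrite -e addrC subrK.
elim: N r => [|N IHN] r e; first by exists (p - q); rewrite mul1r.
have [s es] : exists s, p - q = 'X^N * s.
  by apply: (IHN ('X * r)); rewrite e exprSr mulrA.
have {e} e : c * s = 'X * r.
  apply: (@mulfI _ 'X^N); first by rewrite monic_neq0 ?monicXn.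
  by rewrite mulrCA -es e exprSr mulrA.
have s0 : s`_0 = 0.
  have := congr1 (fun p : {poly int} => p`_0) e.
  by rewrite coefXM coefM big_ord1 c0 mul1r.
exists (drop_poly 1 s); rewrite es exprSr -mulrA; congr (_ * _).
rewrite -[LHS](@poly_take_drop _ 1) expr1 mulrC.
suff ->: take_poly 1 s = 0 by rewrite add0r.
by apply/polyP=> [[|i]]; rewrite coef_take_poly ?s0 ?coef0.
Qed.

(** * Truncated Jacobi triple product *)

(* The exponent of the term of index [j = n - m] in the bilateral theta series
   [\sum_j (-1)^j z^j p^(j(j-1)/2)], for [p = 'X^(a + b)] and [z = 'X^a]. *)
Definition theta_exp a b n m : nat :=
  if (m <= n)%N then ((a + b) * 'C(n - m, 2) + a * (n - m))%N
  else ((a + b) * 'C(m - n, 2) + b * (m - n))%N.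

Definition theta_term a b n m : {poly int} :=
  (-1) ^+ (n + m) * 'X^(theta_exp a b n m).

Definition qprod d k M : {poly int} := \prod_(k <= i < M.+1) (1 - 'X^(d * i)).

Lemma qprod_recl d k M : (k <= M)%N ->
  qprod d k M = (1 - 'X^(d * k)) * qprod d k.+1 M.
Proof. by move=> le; rewrite /qprod big_ltn. Qed.

Lemma binS2 n : 'C(n.+1, 2) = ('C(n, 2) + n)%N.
Proof. by rewrite binS bin1. Qed.

Lemma theta_expSS a b n m : theta_exp a b n.+1 m.+1 = theta_exp a b n m.
Proof. by rewrite /theta_exp ltnS !subSS. Qed.

(** From index j = n - m to j + 1 the exponent grows by (a + b) j + a; terms are moved across so
    that no subtraction in [nat] occurs. *)
Lemma theta_expS a b n m : (theta_exp a b n.+1 m + ((a + b) * m + b)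
  = theta_exp a b n m + (a + b) * n.+1)%N.
Proof.
rewrite /theta_exp; case: (leqP m n) => [le|lt].
  rewrite (leqW le) subSn // binS2; nia.
case: (leqP m n.+1) => [le|lt'].
  have -> : m = n.+1 by lia.
  rewrite subnn subSn // subnn !bin_small //; nia.
have -> : (m - n = (m - n.+1).+1)%N by lia.
rewrite binS2; nia.
Qed.

Lemma theta_exp_ge a b n m : (0 < a)%N -> (n - m <= theta_exp a b n m)%N.
Proof.
move=> a0; rewrite /theta_exp; case: (leqP m n) => [_|/ltnW/eqP -> //].
by apply: leq_trans (leq_addl _ _); rewrite leq_pmull.
Qed.

Lemma theta_exp_ge_sub a b n m : (0 < b)%N -> (m - n <= theta_exp a b n m)%N.
Proof.
move=> b0; rewrite /theta_exp; case: (leqP m n) => [/eqP -> //|_].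
by apply: leq_trans (leq_addl _ _); rewrite leq_pmull.
Qed.

Lemma theta_termSS a b n m : theta_term a b n.+1 m.+1 = theta_term a b n m.
Proof.
by rewrite /theta_term theta_expSS addnS addSn !exprS !mulN1r opprK.
Qed.

Lemma theta_termS a b n m :
  theta_term a b n.+1 m * 'X^((a + b) * m + b)
  = - (theta_term a b n m * 'X^((a + b) * n.+1)).
Proof.
rewrite /theta_term -!mulrA -!exprD theta_expS addSn exprS.
by rewrite mulN1r mulNr.
Qed.

(** The weights make this interpolate: at [m = 0] it is Euler's series, and for large [m] the
    weights disappear modulo ['X^N], leaving the bilateral theta series. *)
Definition theta_sum a b M m : {poly int} :=
  \sum_(0 <= n < M) theta_term a b n m * qprod (a + b) n.+1 M.

(** Shifting the index origin by one releases one factor of the product. The two sides differ by a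
    sum telescoping along [U], where [U 0] vanishes and [U M] has order at least [N] because
    [N + m < M]. *)
Lemma theta_sumS a b N M m : (0 < a)%N -> (N + m < M)%N ->
  eqm N (theta_sum a b M m.+1) ((1 - 'X^((a + b) * m + b)) * theta_sum a b M m).
Proof.
move=> a0 ltM.
pose U n : {poly int} := qprod (a + b) n.+1 M *
  (theta_term a b n m.+1 + 'X^((a + b) * m + b) * theta_term a b n m).
have U0 : U 0%N = 0.
  rewrite /U; suff -> : theta_term a b 0 m.+1
    = - ('X^((a + b) * m + b) * theta_term a b 0 m) by rewrite addNr mulr0.
  have := theta_expS a b 0 m.+1; rewrite theta_expSS /theta_term => e.
  have -> : theta_exp a b 0 m.+1 = ((a + b) * m + b + theta_exp a b 0 m)%N.
    nia.
  by rewrite !add0n exprS exprD mulN1r mulNr mulrCA.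
  have UM : eqm N (U M) 0.
  rewrite /U /theta_term !mulrDr !mulrA -[0]addr0.
  apply: eqmD; apply: eqmXn0; apply: leq_trans (theta_exp_ge _ _ _ a0); lia.
suff -> : theta_sum a b M m.+1
  = (1 - 'X^((a + b) * m + b)) * theta_sum a b M m - (U M - U 0%N).
  apply: eqm_trans (eqmB (eqm_refl _ _) (eqmB UM (eqm_refl _ _))) _.
  by rewrite U0 !subr0; apply: eqm_refl.
rewrite -telescope_sumr // mulr_sumr -sumrB; apply: eq_big_nat => n /andP[_ nM].
rewrite /U theta_termSS.
rewrite (qprod_recl _ nM).
set q := qprod _ _ _.
have := theta_termS a b n m.
move: ('X^_) ('X^_) (theta_term _ _ _ _) (theta_term _ _ _ _).
move: (theta_term _ _ _ _) => x y z w v e.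
by ring: e.
Qed.

(** With p = X^d and z = X^c, this is Euler's series of terms (-1)^n p^(n(n-1)/2) z^n / (p)_n for
    (z; p)_oo, multiplied by (p)_M to clear denominators. *)
Definition euler_sum d c M : {poly int} :=
  \sum_(0 <= n < M) (-1) ^+ n * 'X^(d * 'C(n, 2) + c * n) * qprod d n.+1 M.

(** The functional equation (z; p)_oo = (1 - z) (zp; p)_oo, again by telescoping; the factor
    [1 - 'X^(d * n)] makes [U 0] vanish. *)
Lemma euler_sumS d c N M : (0 < c)%N -> (N <= M)%N ->
  eqm N (euler_sum d c M) ((1 - 'X^c) * euler_sum d (c + d) M).
Proof.
move=> c0 leM.
pose U n : {poly int} := (-1) ^+ n * (1 - 'X^(d * n)) * qprod d n.+1 M *
  'X^(d * 'C(n, 2) + c * n).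
have U0 : U 0%N = 0 by rewrite /U muln0 expr0 subrr mulr0 !mul0r.
have UM : eqm N (U M) 0 by apply: eqmXn0; nia.
suff -> : euler_sum d c M
  = (1 - 'X^c) * euler_sum d (c + d) M - (U M - U 0%N).
  apply: eqm_trans (eqmB (eqm_refl _ _) (eqmB UM (eqm_refl _ _))) _.
  by rewrite U0 !subr0; apply: eqm_refl.
rewrite -telescope_sumr // mulr_sumr -sumrB; apply: eq_big_nat => n /andP[_ nM].
rewrite /U (qprod_recl _ nM) binS2 exprS mulN1r.
rewrite !(mulnDr, mulnDl, mulnS) !exprD.
move: ('X^_) ('X^_) ('X^_) ('X^_) ((-1) ^+ n) (qprod _ _ _) => *; ring.
Qed.

Lemma qprod1E d M : qprod d 1 M = \prod_(0 <= i < M) (1 - 'X^(d * i.+1)).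
Proof. by rewrite /qprod big_add1. Qed.

Lemma eqm_qprod1 N d k M : (N <= d * k)%N -> eqm N (qprod d k M) 1.
Proof.
move=> le; rewrite /qprod.
have [lt|ge] := leqP k M.+1; last first.
  by rewrite big_geq; [apply: eqm_refl|apply: ltnW].
elim: M.+1 lt => [|n IHn] lt.
  by rewrite big_geq; [apply: eqm_refl|].
move: lt; rewrite leq_eqVlt => /predU1P[->|lt].
  by rewrite big_geq; [apply: eqm_refl|].
rewrite big_nat_recr //= -[1 in X in eqm _ _ X]mulr1; apply: eqmM;
  first exact: IHn.
rewrite -[X in eqm _ _ X]subr0; apply: eqmB; first exact: eqm_refl.
by rewrite -[X in eqm _ X]mul1r; apply: eqmXn0; nia.
Qed.

(** After [N] uses of [euler_sumS] the argument has order at least [N], so only the term n = 0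
    survives, which is [qprod d 1 M]. *)
Lemma euler_product d a N M : (0 < a)%N -> (0 < d)%N -> (N <= M)%N ->
  eqm N (euler_sum d a M)
    (qprod d 1 M * \prod_(0 <= i < N) (1 - 'X^(d * i + a))).
Proof.
move=> a0 d0 leM.
suff h s : eqm N (euler_sum d a M)
    (euler_sum d (a + d * s) M * \prod_(0 <= i < s) (1 - 'X^(d * i + a))).
  apply: eqm_trans (h N) _; apply: eqmM; last exact: eqm_refl.
  have [M0|M0] := posnP M.
    by move: leM; rewrite M0 leqn0 => /eqP ->; apply: eqm0.
  rewrite /euler_sum big_ltn // bin0n !muln0 addn0 !expr0 !mul1r -[X in eqm _ _
    X]addr0.
  apply: eqmD; first exact: eqm_refl.
  apply: eqm_sum0 => n; rewrite mem_index_iota => /andP[n0 _].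
  rewrite mulrAC; apply: eqmXn0; apply: leq_trans (leq_addl _ _).
  by apply: leq_trans (leq_pmulr _ n0); apply: leq_trans (leq_addl _ _);
    rewrite leq_pmull.
elim: s => [|s IHs]; first by rewrite muln0 addn0 big_geq // mulr1;
  exact: eqm_refl.
apply: eqm_trans IHs _;
  rewrite big_nat_recr //= [_ * (1 - _)]mulrC [X in eqm _ _ X]mulrA.
apply: eqmM (eqm_refl _ _).
rewrite mulnS [(d + _)%N]addnC addnA [(d * s + a)%N]addnC mulrC.
by apply: euler_sumS => //; rewrite addn_gt0 a0.
Qed.

(** [N] index shifts lead from Euler's series to the theta series and collect the factors with
    offset [b]; Euler's product supplies the other two families. *)
Lemma triple_product a b N : (0 < a)%N -> (0 < b)%N ->
  eqm N (\sum_(0 <= n < N) (-1) ^+ n *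
           ('X^((a + b) * 'C(n, 2) + b * n)
            - 'X^((a + b) * 'C(n.+1, 2) + a * n.+1)))
    (\prod_(0 <= i < N) ((1 - 'X^((a + b) * i.+1)) *
       (1 - 'X^((a + b) * i + a)) * (1 - 'X^((a + b) * i + b)))).
Proof.
(* With [M = 2N + 1] the indices j = n - N run from -N to N, and all [N] shifts are within reach of
   [theta_sumS]. *)
move=> a0 b0; pose M := (N + N).+1; pose d := (a + b)%N.
have d0 : (0 < d)%N by rewrite addn_gt0 a0.
have theta_prod s : (s <= N)%N -> eqm N (theta_sum a b M s)
    (theta_sum a b M 0 * \prod_(0 <= i < s) (1 - 'X^(d * i + b))).
  elim: s => [|s IHs] les; first by rewrite big_geq // mulr1; exact: eqm_refl.
  apply: eqm_trans (theta_sumS _ _ _) _ => //; first by rewrite /M; lia.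
  rewrite big_nat_recr //= mulrA mulrC; apply: eqmM (eqm_refl _ _).
  exact/IHs/ltnW.
have theta0 : theta_sum a b M 0 = euler_sum d a M.
  by apply: eq_big_nat => n _; rewrite /theta_term /theta_exp leq0n subn0 addn0.
(* The term has order at least N - n and its weight is 1 modulo X^(d(n+1)). *)
have thetaN : eqm N (theta_sum a b M N) (\sum_(0 <= n < M) theta_term a b n N).
  apply: eqm_sum => n _; rewrite /theta_term -[X in eqm _ _ X]mulr1 -!mulrA.
  apply: eqmMl; apply: (@eqmXnM _ (d * n.+1)); last exact: eqm_qprod1.
  by have := theta_exp_ge_sub a n N b0; have := leq_pmull n.+1 d0; lia.
apply: (@eqm_trans _ (\sum_(0 <= n < M) theta_term a b n N)); last first.
  apply: eqm_trans (eqm_sym thetaN) _.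
  apply: eqm_trans (theta_prod N (leqnn _)) _; rewrite theta0 !big_split /=.
  apply: eqmM (eqm_refl _ _).
  apply: eqm_trans (euler_product a0 d0 _) _; first by rewrite /M; lia.
  apply: eqmM (eqm_refl _ _).
  rewrite -qprod1E /qprod (@big_cat_nat _ _ _ N.+1) //=; last by rewrite /M;
    lia.
  rewrite -[X in eqm _ _ X]mulr1; apply: eqmMl.
  by apply: eqm_qprod1; nia.
apply: eqm_sym.
(* The term j = -N is negligible; the others are paired as j = -n and j = n + 1 for n < N. *)
rewrite big_ltn // addrC -[X in eqm _ _ X]addr0.
apply: eqmD; last first.
  by apply: eqmXn0; have := theta_exp_ge_sub a 0 N b0; rewrite subn0.
rewrite (@big_cat_nat _ _ _ N.+1) //=; last by rewrite /M; lia.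
rewrite big_nat_rev big_add1 /= -{2}[N.+1]add0n big_addn.
have -> : (M - N.+1 = N)%N by rewrite /M; lia.
rewrite -big_split /=; apply: eqm_sum => n; rewrite mem_index_iota => /= nN.
have -> : (1 + N.+1 - n.+2 = N - n)%N by lia.
have -> : theta_term a b (N - n) N = (-1) ^+ n * 'X^(d * 'C(n, 2) + b * n).
  rewrite /theta_term -signr_odd -[in RHS]signr_odd; congr (_ ^+ _ * 'X^_).
    by congr nat_of_bool; lia.
  rewrite /theta_exp leqNgt; case: n nN => [|n] nN.
    by rewrite subn0 ltnn /= subnn !muln0.
  by rewrite (_ : N - n.+1 < N)%N 1?subKn //; lia.
have -> : theta_term a b (n + N.+1) N
    = (-1) ^+ n.+1 * 'X^(d * 'C(n.+1, 2) + a * n.+1).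
  rewrite /theta_term -signr_odd -[in RHS]signr_odd.
  congr (_ ^+ _ * 'X^_); first by congr nat_of_bool; lia.
  by rewrite /theta_exp (_ : N <= n + N.+1)%N 1?(_ : n + N.+1 - N = n.+1)%N //;
    lia.
by rewrite exprS mulN1r mulNr mulrBr; apply: eqm_refl.
Qed.

(** * Andrews' series *)

Definition poch n m : {poly int} := \prod_(0 <= j < m) (1 - 'X^(n + j.+1)).

Lemma pochS n m : poch n m.+1 = poch n m * (1 - 'X^(n + m.+1)).
Proof. by rewrite /poch big_nat_recr. Qed.

Lemma poch_recl n m : poch n m.+1 = (1 - 'X^(n.+1)) * poch n.+1 m.
Proof.
rewrite /poch big_nat_recl // addn1; congr (_ * _).
by apply: eq_bigr => j _; rewrite addSnnS.
Qed.

Lemma eqm_poch N n m k : (N <= n + m.+1)%N -> (m <= k)%N ->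
  eqm N (poch n k) (poch n m).
Proof.
move=> leN /subnKC <-; elim: (k - m)%N => [|j IHj].
  by rewrite addn0; apply: eqm_refl.
rewrite addnS pochS -[X in eqm _ _ X]mulr1; apply: eqmM => //.
rewrite -[X in eqm _ _ X]subr0; apply: eqmB; first exact: eqm_refl.
by rewrite -[X in eqm _ X]mul1r; apply: eqmXn0; lia.
Qed.

(** [K_i(m)] cut off at n < M, with 7n(n+1)/2 - in rewritten as 7n(n-1)/2 + (7 - i)n. *)
Definition andrews_sum i M m : {poly int} :=
  \sum_(0 <= n < M) (-1) ^+ n * 'X^(3 * m * n + 7 * 'C(n, 2) + (7 - i) * n) *
    (1 - 'X^(i * (m + n.*2.+1))) * poch n m.

Lemma andrews_sum0 M m : andrews_sum 0 M m = 0.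
Proof. by rewrite /andrews_sum big1 // => n _;
  rewrite mul0n subrr mulr0 mul0r. Qed.

Lemma andrews_sum_large N i M m : (0 < i)%N -> (0 < M)%N -> (N <= m)%N ->
  eqm N (andrews_sum i M m) (poch 0 m).
Proof.
move=> i0 M0 leN; rewrite /andrews_sum big_ltn // -[X in eqm _ _ X]addr0.
apply: eqmD; last first.
  apply: eqm_sum0 => n; rewrite mem_index_iota => /andP[n0 _].
  by rewrite -mulrA mulrAC; apply: eqmXn0; nia.
rewrite -[X in eqm _ _ X]mul1r; apply: eqmM (eqm_refl _ _).
rewrite bin0n !muln0 expr0 !mul1r -[X in eqm _ _ X]subr0.
apply: eqmB; first exact: eqm_refl.
by rewrite -[X in eqm _ X]mul1r; apply: eqmXn0; nia.
Qed.

(** With x = q^n and y = q^(m+1), the term of K_(a+1)(m) - K_a(m) has the factor (1 - x) + x (y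
    x^2)^a (1 - xy). The part 1 - x gives [U n]. In the other part 1 - xy extends [poch n m] to
    [poch n m.+1]; subtracting the term of q^(a(m+1)) K_b(m+1) leaves the negative of [U n.+1], so
    the sum telescopes. *)
Lemma andrews_sumS N M a b m : (a + b = 3)%N -> (N <= M)%N ->
  eqm N (andrews_sum a.+1 M m)
    (andrews_sum a M m + 'X^(a * m.+1) * andrews_sum b M m.+1).
Proof.
move=> ab leM.
pose U n : {poly int} := (-1) ^+ n * (1 - 'X^n) * poch n m *
  'X^(3 * m * n + 7 * 'C(n, 2) + (6 - a) * n).
have U0 : U 0%N = 0 by rewrite /U subrr mulr0 !mul0r.
have UM : eqm N (U M) 0.
  by apply: eqmXn0; apply: leq_trans (leq_addl _ _); apply: leq_trans leM _;
    nia.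
suff -> : andrews_sum a.+1 M m = andrews_sum a M m +
    'X^(a * m.+1) * andrews_sum b M m.+1 - (U M - U 0%N).
  apply: eqm_trans (eqmB (eqm_refl _ _) (eqmB UM (eqm_refl _ _))) _.
  by rewrite U0 !subr0; apply: eqm_refl.
rewrite -telescope_sumr // mulr_sumr -big_split -sumrB /=.
apply: eq_big_nat => n /andP[_ nM].
set M0 : {poly int} := 'X^(3 * m * n + 7 * 'C(n, 2) + (6 - a) * n).
set x : {poly int} := 'X^n; set y : {poly int} := 'X^(m.+1).
have b3 : b = (3 - a)%N by lia.
have a3 : (a <= 3)%N by lia.
have -> : U n.+1 = - ((-1) ^+ n * (poch n m * (1 - x * y)) *
    (M0 * x ^+ 7 * y ^+ 3 * 'X^b)).
  rewrite /U -(mulrA ((-1) ^+ n.+1)) -poch_recl pochS exprS mulN1r !mulNr.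
  rewrite /M0 /x /y -!exprM -!exprD binS2; congr (- (_ * (_ * (1 - _)) * 'X^_)).
  by move: a3 {U0 UM}; rewrite b3 {U}; case: a {b3 ab M0} => [|[|[|[]]]] //;
    nia.
have -> : U n = (-1) ^+ n * (1 - x) * poch n m * M0 by [].
have -> : 'X^(3 * m * n + 7 * 'C(n, 2) + (7 - a) * n) = M0 * x.
  by rewrite -exprD; congr 'X^_; nia.
have -> : 'X^(3 * m.+1 * n + 7 * 'C(n, 2) + (7 - b) * n) = M0 * x ^+ a.*2.+1.
  by rewrite -exprM -exprD; congr 'X^_; nia.
have powk k : 'X^(k * (m + n.*2.+1)) = (y * x ^+ 2) ^+ k.
  by rewrite -exprM -exprD -exprM; congr 'X^_; nia.
have -> : 'X^(b * (m.+1 + n.*2.+1)) = (y * x ^+ 2 * 'X) ^+ b.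
  by rewrite -exprM -exprD -exprSr -exprM; congr 'X^_; nia.
have -> : 'X^(a * m.+1) = y ^+ a by rewrite -exprM mulnC.
rewrite pochS exprD -/x -/y !powk {powk};
  move: M0 x y ((-1) ^+ n) (poch n m) => M0 x y s p.
(* For each of the four values of [a] the exponents become numerals. *)
move: a3; rewrite b3 {b b3 ab U U0 UM}; case: a => [|[|[|[]]]] //= _; ring.
Qed.

(** * Generating functions of the enumerations *)

Definition gf (T : Type) (w : T -> nat) (E : seq T) : {poly int} :=
  \sum_(x <- E) 'X^(w x).

Lemma coef_gf (T : Type) (w : T -> nat) (E : seq T) n :
  (gf w E)`_n = (count (fun x => w x == n) E)%:R.
Proof.
rewrite /gf; elim: E => [|x E IHE]; first by rewrite big_nil coef0.
by rewrite big_cons coefD IHE coefXn natrD eq_sym.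
Qed.

Lemma gf_cat (T : Type) (w : T -> nat) (E F : seq T) :
  gf w (E ++ F) = gf w E + gf w F.
Proof. exact: big_cat. Qed.

Lemma gf_nil (T : Type) (w : T -> nat) : gf w [::] = 0.
Proof. exact: big_nil. Qed.

Lemma gf_map (T : Type) (w : T -> nat) (f : T -> T) k (E : seq T) :
  (forall x, w (f x) = (k + w x)%N) -> gf w (map f E) = 'X^k * gf w E.
Proof.
move=> wf; rewrite /gf big_map mulr_sumr.
by apply: eq_bigr => x _; rewrite wf exprD.
Qed.

(** Each unit of fuel either raises the bound [m] or takes a part [m.+1], which may then be
    repeated. Fuel [f] reaches all lists of sum at most [m + f]. *)
Fixpoint rparts (P : pred nat) f m : seq (seq nat) :=
  if f is f'.+1 then
    rparts P f' m.+1 ++ (if P m.+1 then map (cons m.+1) (rparts P f' m) else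
      [::])
  else [:: [::]].

Definition weight (x : seq nat * seq nat) := (2 * sumn x.1 + sumn x.2)%N.

Definition consl a (x : seq nat * seq nat) := (a :: x.1, x.2).
Definition consr a (x : seq nat * seq nat) := (x.1, a :: x.2).

(* Ascending lists [(h, l)] standing for [pi = 2h] and [lambda = l]: the parts
   of [h] exceed [t], those of [l] exceed [s + t + r], and the next part [x] of
   [h] forbids [s + x], [s + x + 1], [s + x + 2] in [l].  The shift [s] grows
   along [h] exactly when [e] is set, so [e = false] describes [B] and
   [e = true] describes [C]. *)
Fixpoint pairs (e : bool) f s t (r : bool) : seq (seq nat * seq nat) :=
  if f is f'.+1 then
    pairs e f' s t.+1 false ++
    (if r then [::] else map (consr (s + t).+1%N) (pairs e f' s t.+1 false)) ++
    map (consl t.+1) (pairs e f' (e + s)%N t.+2 (~~ e))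
  else [:: ([::], [::])].

Lemma gf_consl a E : gf weight (map (consl a) E) = 'X^(2 * a) * gf weight E.
Proof. by apply: gf_map => x; rewrite /weight /= mulnDr addnA. Qed.

Lemma gf_consr a E : gf weight (map (consr a) E) = 'X^a * gf weight E.
Proof. by apply: gf_map => x; rewrite /weight /= addnCA. Qed.

Lemma gf_pairsS e f s t r : gf weight (pairs e f.+1 s t r) =
  (if r then 1 else 1 + 'X^((s + t).+1)) * gf weight (pairs e f s t.+1 false)
  + 'X^(2 * t.+1) * gf weight (pairs e f (e + s)%N t.+2 (~~ e)).
Proof.
rewrite /= !gf_cat gf_consl; case: r; first by rewrite gf_nil; ring.
by rewrite gf_consr; ring.
Qed.

Lemma gf_pair0 : gf weight [:: ([::], [::])] = 1.
Proof. by rewrite /gf big_seq1. Qed.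

(** * The series of B and Andrews' series *)

(** Together the relations express [u m] and [v m] through larger indices exactly as [gf_pairsS]
    does for [r = false] and [r = true], so the limit [c] determines both. *)
Lemma pairsB_unique N (u v : nat -> {poly int}) c :
  (forall m, eqm N (u m) (v m + 'X^(m.+1) * u m.+1)) ->
  (forall m, eqm N (v m) (u m.+1 + 'X^(2 * m.+1) * v m.+2)) ->
  (forall m, (N <= m)%N -> eqm N (u m) c) ->
  forall f m r, (N <= m + f)%N ->
  eqm N (if r then v m else u m) (c * gf weight (pairs false f 0 m r)).
Proof.
move=> hu hv large; elim=> [|f IHf] m r leN.
  rewrite addn0 in leN; rewrite gf_pair0 mulr1; case: r; last exact: large.
  (* The limit of [v] follows from that of [u], as X^(m+1) is 0 modulo X^N. *)
  have [s es] := hu m; have [s1 e1] := large _ leN.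
  have [s2 e2] := large _ (leqW leN).
  have e : v m = u m - 'X^(m.+1) * u m.+1 - 'X^N * s by rewrite es; ring.
  rewrite e e1 e2; have -> : m.+1 = (N + (m.+1 - N))%N by lia.
  exists (s1 - s - 'X^(m.+1 - N) * (c + 'X^N * s2)); rewrite exprD; ring.
have {}IHf m' r' : (N <= m' + f)%N ->
    eqm N (c * gf weight (pairs false f 0 m' r')) (if r' then v m' else u m').
  by move=> le; apply/eqm_sym/IHf.
rewrite gf_pairsS mulrDr mulrCA [c * ('X^_ * _)]mulrCA; apply: eqm_sym.
have e1 := IHf m.+1 false; have e2 := IHf m.+2 true.
apply: (@eqm_trans _ ((if r then 1 else 1 + 'X^(m.+1)) * u m.+1 + 'X^(2 * m.+1)
  * v m.+2)).
  by apply: eqmD; apply: eqmMl; [apply: e1|apply: e2]; lia.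
apply: eqm_sym; case: r; first by rewrite mul1r.
apply: eqm_trans (hu m) _; rewrite mulrDl mul1r addrAC.
by apply: eqmD (eqm_refl _ _).
Qed.

(** K_1 and K_2 are eliminated: K_1(k) = K_3(k+1), and K_2(m+1) = K_3(m+1) - q^(2m+4) K_3(m+3).
    Inserting these in K_3(m) = K_1(m) + q^(m+1) K_2(m+1) + q^(2m+2) K_1(m+1) gives the relation for
    [v]. *)
Lemma andrews_pairsB N M P f m : (0 < M)%N -> (N <= M)%N -> (N <= P)%N ->
  (N <= m + f)%N ->
  eqm N (andrews_sum 3 M m) (poch 0 P * gf weight (pairs false f 0 m false)).
Proof.
move=> M0 leM leP.
pose u := andrews_sum 3 M.
pose v m := u m - 'X^(m.+1) * u m.+1.
apply: (@pairsB_unique N u v (poch 0 P) _ _ _ f m false) => {f}m.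
- by rewrite subrK; apply: eqm_refl.
- have [s1 e1] := @andrews_sumS N M 1 2 m erefl leM.
  have [s2 e2] := @andrews_sumS N M 2 1 m erefl leM.
  have [s3 e3] := @andrews_sumS N M 2 1 m.+1 erefl leM.
  have e0 k := @andrews_sumS N M 0 3 k erefl leM.
  have [s4 e4] := e0 m; have [s5 e5] := e0 m.+1; have [s6 e6] := e0 m.+2.
  exists (s1 + s2 - 'X^(m.+1) * s3 + s4 + 'X^(2 * m.+1) * s5 - 'X^(m.+1) *
    'X^(2 * m.+2) * s6).
  rewrite /v /u e2 e1 e4 e3 e5 e6 ?(mul0n, mul1n, mul2n) -?addnn ?exprD ?exprS
    expr0.
  by rewrite !andrews_sum0; ring.
move=> leN; apply: eqm_trans (andrews_sum_large _ M0 leN) _ => //.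
have [le|lt] := leqP m P; last by apply: eqm_poch; lia.
by apply: eqm_sym; apply: eqm_poch; lia.
Qed.

(** * The series of C and its comparison with that of B *)

Lemma pairsC_one N f s t : (N <= t)%N ->
  eqm N (gf weight (pairs true f s t false)) 1.
Proof.
elim: f s t => [|f IHf] s t leN; first by rewrite gf_pair0; apply: eqm_refl.
rewrite gf_pairsS -[X in eqm _ _ X]addr0; apply: eqmD.
  rewrite -[X in eqm _ _ X]mulr1; apply: eqmM; last by apply: IHf; lia.
  rewrite -[X in eqm _ _ X]addr0; apply: eqmD (eqm_refl _ _) _.
  by rewrite -[X in eqm _ X]mul1r; apply: eqmXn0; lia.
by rewrite mulrC; apply: eqmXn0; lia.
Qed.

Lemma pairsC_stable N f s t : (N <= t + f)%N ->
  eqm N (gf weight (pairs true f.+1 s t false))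
    (gf weight (pairs true f s t false)).
Proof.
elim: f s t => [|f IHf] s t leN.
  by rewrite gf_pair0; apply: pairsC_one; lia.
rewrite gf_pairsS [X in eqm _ _ X]gf_pairsS.
by apply: eqmD; apply: eqmMl; apply: IHf; lia.
Qed.

(** Modulo X^N one more unit of fuel changes nothing, so with fuel fixed at [N] the unfolding
    equation closes on itself. *)
Lemma pairsC_rec N s t : let c s t := gf weight (pairs true N s t false) in
  eqm N (c s t)
    ((1 + 'X^((s + t).+1)) * c s t.+1 + 'X^(2 * t.+1) * c s.+1 t.+2).
Proof.
rewrite /=; have := @pairsC_stable N N s t (leq_addl _ _).
by rewrite gf_pairsS => /eqm_sym.
Qed.

(* The defect of this relation satisfies the linear recurrence [pairsC_rec] and
   is negligible for large [t]. *)
Lemma pairsC_contiguous N s t :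
  let c s t := gf weight (pairs true N s t false) in
  eqm N (c s.+1 t) (c s t.+1 + 'X^(2 * t.+1) * c s.+1 t.+2).
Proof.
move=> c.
suff h f : (N <= t + f)%N ->
    eqm N (c s.+1 t - c s t.+1 - 'X^(2 * t.+1) * c s.+1 t.+2) 0.
  have [| r e] := h N; first exact: leq_addl.
  by exists r; rewrite -[_ * r]add0r -e; ring.
elim: f s t => [|f IHf] s t; rewrite ?addn0 => leN.
  have e0 : 0 = 1 - 1 - 0 :> {poly int} by ring.
  rewrite [X in eqm _ _ X]e0; apply: eqmB; first apply: eqmB.
  - exact: pairsC_one.
  - by apply: pairsC_one; lia.
  by rewrite mulrC; apply: eqmXn0; lia.
have {}IHf s' t' : (t < t')%N -> exists r,
    c s'.+1 t' = c s' t'.+1 + 'X^(2 * t'.+1) * c s'.+1 t'.+2 + 'X^N * r.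
  move=> ltt; have [| r e] := IHf s' t'; first by lia.
  by exists r; rewrite -[_ * r]add0r -e; ring.
have crec s' t' : exists r, c s' t' = (1 + 'X^((s' + t').+1)) * c s' t'.+1
    + 'X^(2 * t'.+1) * c s'.+1 t'.+2 + 'X^N * r := pairsC_rec N s' t'.
have [r1 e1] := crec s.+1 t; have [r2 e2] := crec s t.+1.
have [r3 e3] := crec s.+1 t.+2.
have [| r4 e4] := IHf s t.+1; first by [].
have [| r5 e5] := IHf s.+1 t.+2; first by lia.
(* The defect D satisfies D(s,t) = (1 + q^(s+t+2)) D(s,t+1) + q^(2t+2) D(s+1,t+2); the witness
   combines the remainders accordingly. *)
exists (r1 - r2 - 'X^(2 * t.+1) * r3 + (1 + 'X^((s + t).+2)) * r4
        + 'X^(2 * t.+1) * r5).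
rewrite e1 e2 e3 e4 e5 !addnS !addSn !mul2n -?addnn ?exprD ?exprS.
ring.
Qed.

(** The series with shift 1 takes the role of [B'_m]: its relation is [pairsC_contiguous] at s = 0,
    and subtracting that from [pairsC_rec] gives the other one. *)
Lemma pairsC_pairsB N f m : (N <= m + f)%N ->
  eqm N (gf weight (pairs true N 0 m false))
    (gf weight (pairs false f 0 m false)).
Proof.
rewrite -[X in eqm _ _ X]mul1r.
pose u k := gf weight (pairs true N 0 k false).
pose v k := gf weight (pairs true N 1 k false).
apply: (@pairsB_unique N u v 1 _ _ _ f m false) => {f}m.
- have [s1 e1] := pairsC_rec N 0 m; have [s2 e2] := pairsC_contiguous N 0 m.
  by exists (s1 - s2); rewrite /u /v e1 e2 add0n; ring.
- exact: pairsC_contiguous.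
- by move=> leN; apply: pairsC_one.
Qed.

(** * The product side *)

(** Lists that take the part m + 1 carry the factor X^(m+1), which makes up for the smaller modulus
    known for the same bound with less fuel. *)
Lemma gf_rparts (P : pred nat) f m K : (m + f <= K)%N ->
  eqm (m + f)
    (gf sumn (rparts P f m) * \prod_(m <= j < K | P j.+1) (1 - 'X^(j.+1))) 1.
Proof.
elim: f m => [|f IHf] m leK.
  rewrite /gf big_seq1 expr0 mul1r addn0 big_nat_cond.
  elim/big_rec: _ => [|j p /andP[/andP[mj _] _] IHp]; first exact: eqm_refl.
  rewrite -[X in eqm _ _ X]mulr1; apply: eqmM => //.
  rewrite -[X in eqm _ _ X]subr0; apply: eqmB; first exact: eqm_refl.
  by rewrite -[X in eqm _ X]mul1r; apply: eqmXn0; lia.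
have := IHf m.+1; rewrite addSnnS => /(_ leK) IH1.
rewrite /= gf_cat big_ltn_cond; last by lia.
case: ifP => Pm; last by rewrite gf_nil addr0.
rewrite (@gf_map _ sumn _ m.+1) // mulrDl mulrCA.
have e : 1 = (1 - 'X^(m.+1)) * 1 + 'X^(m.+1) * 1 :> {poly int} by ring.
rewrite [X in eqm _ _ X]e; apply: eqmD; first exact: eqmMl.
rewrite -mulrA; apply: (@eqmXnM _ (m + f)); first by lia.
have := IHf m; rewrite [X in _ * X]big_ltn_cond ?Pm; last by lia.
by apply; lia.
Qed.

Lemma pm2_pm3_mod7D i r : pm2_pm3_mod7 (7 * i + r)%N = pm2_pm3_mod7 r.
Proof. by rewrite /pm2_pm3_mod7; lia. Qed.

(** In each block of seven factors the residues 0, 1, 6 go to the first product and 2, 3, 4, 5 to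
    the second. The modulus is kept as 1 + 6 to match [triple_product] with a = 1, b = 6. *)
Lemma poch_split7 N : poch 0 (7 * N) =
  (\prod_(0 <= i < N) ((1 - 'X^((1 + 6) * i.+1)) *
    (1 - 'X^((1 + 6) * i + 1)) * (1 - 'X^((1 + 6) * i + 6)))) *
  \prod_(0 <= j < 7 * N | pm2_pm3_mod7 j.+1) (1 - 'X^(j.+1)).
Proof.
rewrite [X in _ = _ * X]big_mkcond.
elim: N => [|N IHN]; first by rewrite muln0 /poch !big_geq // mulr1.
have -> : (7 * N.+1 = (7 * N).+3.+4)%N by lia.
set k := (7 * N)%N.
rewrite !pochS !add0n IHN -/k !(big_nat_recr k.+1, big_nat_recr k.+2,
  big_nat_recr k.+3, big_nat_recr k.+4, big_nat_recr k.+4.+1,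
  big_nat_recr k.+4.+2, big_nat_recr k, big_nat_recr N) //=.
have Pk r : pm2_pm3_mod7 (r + k)%N = pm2_pm3_mod7 r.
  by rewrite addnC pm2_pm3_mod7D.
rewrite !(Pk 1%N, Pk 2, Pk 3, Pk 4, Pk 5, Pk 6, Pk 7) /=.
have -> : ((1 + 6) * N.+1 = k.+3.+4)%N by lia.
have -> : ((1 + 6) * N + 1 = k.+1)%N by lia.
have -> : ((1 + 6) * N + 6 = k.+2.+4)%N by lia.
ring.
Qed.

(** At m = 0 the factor [poch] is empty, and the two terms of 1 - q^(2n+1) yield the theta exponents
    of the indices -n and n + 1. *)
Lemma theta_poch N : eqm N (andrews_sum 1 N 0)
  (\prod_(0 <= i < N) ((1 - 'X^((1 + 6) * i.+1)) *
    (1 - 'X^((1 + 6) * i + 1)) * (1 - 'X^((1 + 6) * i + 6)))).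
Proof.
apply: eqm_trans (triple_product N _ _) => //.
suff -> : andrews_sum 1 N 0 = \sum_(0 <= n < N) (-1) ^+ n *
   ('X^((1 + 6) * 'C(n, 2) + 6 * n) - 'X^((1 + 6) * 'C(n.+1, 2) + 1 * n.+1)).
  exact: eqm_refl.
apply: eq_bigr => n _; rewrite /poch big_geq // mulr1 -mulrA; congr (_ * _).
rewrite mulrBr mulr1 -exprD binS2.
by congr ('X^_ - 'X^_); lia.
Qed.

Lemma coef0_prod_subXn (P : pred nat) m n :
  (\prod_(m <= j < n | P j) (1 - 'X^(j.+1) : {poly int}))`_0 = 1.
Proof.
elim/big_rec: _ => [|j p _ e]; first by rewrite coef1.
by rewrite coef0M e coefB coef1 coefXn subr0.
Qed.

(** After multiplication by (q)_(7N) = T Q, the left side reduces to T, that is K_1(0) = K_3(1), and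
    the right side to K_3(1). The bound 1 says that the parts of h and lambda exceed 1. *)
Lemma rparts_pairsB N :
  eqm N (gf sumn (rparts pm2_pm3_mod7 N 0)) (gf weight (pairs false N 0 1
    false)).
Proof.
case: N => [|n]; first exact: eqm0.
set N := n.+1.
set T : {poly int} := \prod_(0 <= i < N) ((1 - 'X^((1 + 6) * i.+1)) *
    (1 - 'X^((1 + 6) * i + 1)) * (1 - 'X^((1 + 6) * i + 6))).
set Q : {poly int} := \prod_(0 <= j < 7 * N | pm2_pm3_mod7 j.+1) (1 -
  'X^(j.+1)).
apply: (@eqm_cancel N (T * Q)).
  by rewrite -poch_split7 /poch coef0_prod_subXn.
rewrite -{2}poch_split7.
apply: eqm_trans _ (@andrews_pairsB N N (7 * N) N 1 _ _ _ _); try lia.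
rewrite -mulrA [Q * _]mulrC.
apply: (@eqm_trans _ (T * 1)).
  by apply: eqmMl; apply: (@gf_rparts _ N 0 (7 * N)); lia.
rewrite mulr1; apply: eqm_trans (eqm_sym (theta_poch N)) _.
have := @andrews_sumS N N 0 3 0 erefl (leqnn N).
by rewrite andrews_sum0 mul0n expr0 add0r mul1r.
Qed.

Local Close Scope ring_scope.

(** * Correctness of the enumerations *)

Definition gap2 x y := x + 2 <= y.

Fixpoint excluded (e : bool) s (h l : seq nat) : bool :=
  if h is x :: h' then
    [&& s + x \notin l, (s + x).+1 \notin l, (s + x).+2 \notin l &
        excluded e (e + s) h' l]
  else true.

Definition admissible e s t (r : bool) (x : seq nat * seq nat) :=
  [&& sorted gap2 x.1, all (ltn t) x.1, sorted ltn x.2,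
      all (ltn (s + t + r)) x.2 & excluded e s x.1 x.2].

Lemma gap2_trans : transitive gap2.
Proof. by move=> y x z; rewrite /gap2; lia. Qed.

(** All forbidden values are at least s + x for some x in h, hence larger than [a]; the shift only
    grows. *)
Lemma excluded_cons e s h a l : all (fun x => a < s + x) h ->
  excluded e s h (a :: l) = excluded e s h l.
Proof.
elim: h s => //= x h IHh s /andP[ax ah]; rewrite !inE !negb_or IHh.
  have -> : s + x != a by lia.
  have -> : (s + x).+1 != a by lia.
  by have -> : (s + x).+2 != a by lia.
by apply: sub_all ah => y; lia.
Qed.

Lemma notin_all_ltn b a l : all (ltn b) l -> a <= b -> a \notin l.
Proof. by move=> /allP h; apply: contraL => /h /=; rewrite ltnNge. Qed.

Lemma sub_all_ltn a b l : a <= b -> all (ltn b) l -> all (ltn a) l.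
Proof. by move=> le; apply: sub_all => x; apply: leq_ltn_trans. Qed.

Lemma all_ltn_notin a l : all (ltn a) l -> a.+1 \notin l -> all (ltn a.+1) l.
Proof.
move=> /allP h n; apply/allP => z zl /=.
rewrite ltn_neqAle (h z zl : a < z) andbT.
by apply: contraNneq n => ->.
Qed.

(** This is the branching of [pairs]: t + 1 can only be the head. A general [R] covers both [gap2]
    for h and [ltn] for lambda. *)
Lemma all_ltn_behead (R : rel nat) t h :
  transitive R -> subrel R ltn -> sorted R h -> all (ltn t) h ->
  all (ltn t.+1) h \/ exists h', h = t.+1 :: h' /\ all (R t.+1) h'.
Proof.
move=> Rtr Rlt; case: h => [|x h] //=; first by left.
rewrite path_sortedE // => /andP[xh _] /andP[tx _].
have [xt|xt] := eqVneq x t.+1; [right|left].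
  by exists h; rewrite -xt.
have {tx} tx : t.+1 < x by rewrite ltn_neqAle eq_sym xt.
by rewrite tx /=; apply: sub_all xh => y /Rlt; apply: ltn_trans.
Qed.

Lemma pairs_sound e f s t r x : x \in pairs e f s t r -> admissible e s t r x.
Proof.
elim: f s t r x => [|f IHf] s t r x; first by rewrite inE => /eqP ->.
rewrite /= !mem_cat => /or3P[/IHf|xE|/mapP[y /IHf h ->]].
- case/and5P=> h1 h2 h3 h4 h5; rewrite /admissible h1 h3 h5 andbT /=.
  rewrite (sub_all_ltn (leqnSn t) h2) (sub_all_ltn _ h4) //.
  by case: (r); lia.
- case: r xE => // /mapP[y /IHf h ->] {x}.
  case/and5P: h => h1 h2 h3 h4 h5; rewrite /admissible /= h1 path_sortedE //;
    last exact: ltn_trans.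
  rewrite addn0 addnS in h4; rewrite excluded_cons //; last first.
    by apply: sub_all h2 => y' /=; lia.
  rewrite h3 h4 h5 (sub_all_ltn (leqnSn t) h2) addn0 ltnSn.
  by rewrite (sub_all_ltn (leqnSn _) h4).
case/and5P: h => h1 h2 h3 h4 h5; rewrite /admissible /= path_sortedE;
  last exact: gap2_trans.
rewrite h1 h3 h5 ltnSn (sub_all_ltn _ h2) 1?ltnW // andbT.
(* For either [e] the new bound is s + t + 3, the largest value forbidden by the part t + 1. *)
have h4' : all (ltn (s + t).+3) y.2.
  by apply: sub_all_ltn h4; case: (e); rewrite /= ?addnS; lia.
rewrite !(notin_all_ltn h4') ?(sub_all_ltn _ h4') ?addnS //=; try lia.
by rewrite andbT; apply: sub_all h2 => z; rewrite /gap2 /=; lia.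
Qed.

(** Each step spends one unit of fuel and raises [t] by at least one, so the bounds on the sums
    never decrease; once the fuel is spent, any part would exceed them. *)
Lemma pairs_complete e f s t r x : admissible e s t r x ->
  sumn x.1 <= t + f -> sumn x.2 <= s + t + f -> x \in pairs e f s t r.
Proof.
elim: f s t r x => [|f IHf] s t r [h l] /and5P[/= h1 h2 h3 h4 h5] sh sl.
  have hnil k q : all (ltn k) q -> sumn q <= k -> q = [::].
    by case: q => //= a q /andP[+ _]; lia.
  rewrite !addn0 in sh sl; rewrite (hnil _ _ h2 sh).
  by rewrite (hnil _ _ h4 (leq_trans sl (leq_addr _ _))).
rewrite !mem_cat.
have gap2_ltn : subrel gap2 ltn by move=> a b; rewrite /gap2 /=; lia.
have [h2'|[h' [eh h2']]] := all_ltn_behead gap2_trans gap2_ltn h1 h2;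
  last first.
  apply/or3P/Or33/mapP; exists (h', l); last by rewrite eh.
  move: h5 h1 sh; rewrite eh /= => /and4P[n1 n2 n3 h5] /path_sorted h1 sh.
  apply: IHf => /=; [|clear -sh; lia|clear -sl; case: (e); lia].
  rewrite /admissible /= h1 h3 h5 andbT /=.
  apply/andP; split; first by apply: sub_all h2' => z; rewrite /gap2 /=; lia.
  have -> : e + s + t.+2 + ~~ e = (s + t).+3 by clear; case: e; lia.
  have h0 := sub_all_ltn (leq_addr r (s + t)) h4.
  (* The three exclusions lift the lower bound of [l] from s + t to s + t + 3. *)
  by rewrite !addnS in n1 n2 n3; do 3!apply: all_ltn_notin => //.
case: r h4 sl => h4 sl /=.
  apply/orP; left; apply: IHf => /=; [|lia|lia].
  by rewrite /admissible /= h1 h2' h3 h5 addn0 addnS -addn1 h4.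
rewrite addn0 in h4 sl.
have ltn_sub : subrel ltn ltn by [].
have [h4'|[l' [el h4']]] := all_ltn_behead ltn_trans ltn_sub h3 h4.
  apply/orP; left; apply: IHf => /=; [|lia|lia].
  by rewrite /admissible /= h1 h2' h3 h5 addn0 addnS h4'.
apply/or3P/Or32/mapP; exists (h, l'); last by rewrite el.
move: h5 h3 sl; rewrite el /= => h5 /path_sorted h3 sl.
apply: IHf => /=; [|lia|lia].
rewrite /admissible /= h1 h2' h3 addn0 addnS h4' /=.
move: h5; rewrite excluded_cons //.
by apply: sub_all h2' => z /=; lia.
Qed.

(** The three branches are told apart by whether t + 1 lies in h and, if not, whether s + t + 1 lies
    in lambda. *)
Lemma pairs_uniq e f s t r : uniq (pairs e f s t r).
Proof.
elim: f s t r => //= f IHf s t r.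
have cr a : injective (consr a) by move=> [? ?] [? ?] [-> ->].
have cl a : injective (consl a) by move=> [? ?] [? ?] [-> ->].
rewrite !cat_uniq IHf (map_inj_uniq (cl _)) IHf andbT /=.
have -> : uniq (if r then [::] else
    map (consr (s + t).+1) (pairs e f s t.+1 false)).
  by case: (r); rewrite // (map_inj_uniq (cr _)) IHf.
have nt x : x \in pairs e f s t.+1 false ->
    (t.+1 \notin x.1) && ((s + t).+1 \notin x.2).
  move=> /pairs_sound/and5P[_ h2 _ h4 _]; rewrite (notin_all_ltn h2) //.
  by apply: notin_all_ltn h4 _; lia.
apply/andP; split.
  apply/hasPn => x; rewrite mem_cat => /orP[|/mapP[y _ ->]].
    case: (r) => // /mapP[y _ ->]; apply/negP => /nt /andP[_].
    by rewrite inE eqxx.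
  by apply/negP => /nt; rewrite inE eqxx.
apply/hasPn => x /mapP[y _ ->]; case: (r) => //.
by apply/negP => /mapP[z /nt /andP[nz _] [ez _]]; rewrite -ez inE eqxx in nz.
Qed.

Definition aparts (P : pred nat) m s :=
  sorted leq s && all (fun x => (m < x) && P x) s.

Lemma rparts_sound P f m s : s \in rparts P f m -> aparts P m s.
Proof.
elim: f m s => [|f IHf] m s; first by rewrite inE => /eqP ->.
rewrite /= mem_cat => /orP[/IHf/andP[s1 s2]|].
  rewrite /aparts s1; apply: sub_all s2 => x /andP[mx ->].
  by rewrite andbT ltnW.
case: ifP => // Pm /mapP[y /IHf/andP[s1 s2] ->].
rewrite /aparts /= ltnSn Pm s2 path_sortedE ?s1 ?andbT //;
  last exact: leq_trans.
by apply: sub_all s2 => x /andP[].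
Qed.

Lemma rparts_complete P f m s : aparts P m s -> sumn s <= m + f ->
  s \in rparts P f m.
Proof.
elim: f m s => [|f IHf] m s /andP[s1 s2] le.
  by case: s s2 le {s1} => //= a s /andP[/andP[ma _] _]; lia.
rewrite /= mem_cat.
case: s s1 s2 le => [|a s] s1 s2 le; first by rewrite IHf.
have /andP[/andP[ma Pa] s2'] := s2.
have [am|am] := eqVneq a m.+1; [apply/orP; right|apply/orP; left].
  rewrite -am Pa map_f // IHf //; last by move: le => /=; lia.
  by rewrite /aparts (path_sorted s1).
apply: IHf; last by lia.
rewrite /aparts s1; apply/allP => x xs; have /andP[_ ->] := allP s2 x xs.
rewrite andbT (@leq_trans a) //; first by rewrite ltn_neqAle eq_sym am.
move: xs; rewrite inE => /predU1P[-> //|].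
by move: s1; rewrite /= path_sortedE; [case/andP => /allP + _;
  apply|exact: leq_trans].
Qed.

Lemma rparts_uniq P f m : uniq (rparts P f m).
Proof.
elim: f m => //= f IHf m; rewrite cat_uniq IHf.
case: ifP => // _; rewrite map_inj_uniq ?IHf ?andbT; last by move=> ? ? [].
apply/hasPn => _ /mapP[y _ ->]; apply/negP => /rparts_sound/andP[_ /=].
by rewrite ltnn.
Qed.

(** * From cardinalities of finite sets to the enumerations *)

Lemma card_size (T : finType) (U : eqType) (g : T -> U) (D : {set T})
    (E : seq U) :
  injective g -> uniq E ->
  (forall u, u \in E <-> exists2 x, x \in D & g x = u) -> #|D| = size E.
Proof.
move=> ginj Euniq DE; rewrite cardE -(size_map g); apply: perm_size.
apply: uniq_perm; rewrite ?map_inj_uniq ?enum_uniq // => u.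
apply/mapP/idP => [[x xD ->]|/DE[x xD <-]]; last by exists x; rewrite ?mem_enum.
by apply/DE; exists x => //; rewrite -mem_enum.
Qed.

(** Reversal passes from non-increasing to ascending lists. The fuel [n.+1] is the modulus of the
    final comparison. *)
Lemma A_count n :
  A n = count (fun s => sumn s == n) (rparts pm2_pm3_mod7 n.+1 0).
Proof.
have A_rev s : A_part n (rev s) = aparts pm2_pm3_mod7 0 s && (sumn s == n).
  rewrite /A_part /is_partition_of /is_partition rev_sorted mem_rev sumn_rev.
  rewrite all_rev /aparts.
  have -> : (0 \notin s) = all (ltn 0) s.
    apply/idP/allP => [n0 x xs|s0]; last by apply/negP => /s0.
    by rewrite /= lt0n; apply: contraNneq n0 => <-.
  have -> : all (fun x => (0 < x) && pm2_pm3_mod7 x) s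
    = all (ltn 0) s && all pm2_pm3_mod7 s by rewrite -all_predI.
  by rewrite andbAC andbA.
rewrite -size_filter -(size_map rev); apply: card_size.
- exact: parts_inj.
- by rewrite (map_inj_uniq (can_inj revK)) filter_uniq ?rparts_uniq.
move=> s; split.
  case/mapP => t; rewrite mem_filter => /andP[tn /rparts_sound ta] ->.
  have An : A_part n (rev t) by rewrite A_rev ta.
  have /andP[/parts_of_partition[x xt] _] := An.
  by exists x; rewrite // inE xt.
case=> x; rewrite inE => Ax <-; rewrite -[parts x]revK map_f // mem_filter.
rewrite -[parts x]revK A_rev in Ax; case/andP: Ax => xa xn.
by rewrite xn rparts_complete // (eqP xn) add0n.
Qed.

(** The accumulated shift in closed form: the j-th part has i = j - 1, so for s = 0 the shift is 0
    for B and j - 1 for C. *)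
Lemma excludedE e s h l : excluded e s h l =
  all (fun i => let x := s + e * i + nth 0 h i in
         [&& x \notin l, x.+1 \notin l & x.+2 \notin l]) (iota 0 (size h)).
Proof.
elim: h s => //= x h IHh s; rewrite muln0 addn0 -!andbA IHh.
rewrite (iotaDl 1 0) all_map; congr [&& _, _, _ & _]; apply: eq_all => i /=.
by rewrite mulnS addnA [s + _]addnC.
Qed.

Definition bipart (e : bool) n p l :=
  [&& is_bipartition_of n p l, even_gap4 p, distinct_gt1 l &
      excluded e 0 (map half (rev p)) (rev l)].

Lemma B_bipartE n p l : B_bipart n p l = bipart false n p l.
Proof.
rewrite /B_bipart /bipart /B_excluded excludedE size_map size_rev (iotaDl 1 0)
  all_map.
congr [&& _, _, _ & _]; apply: eq_all => i /=.
have -> : asc_part p (1 + i) %/ 2 = nth 0 (map half (rev p)) i.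
  rewrite /asc_part /= divn2; have [lt|ge] := ltnP i (size (rev p)).
    by rewrite (nth_map 0).
  by rewrite !nth_default ?size_map.
by rewrite !mem_rev mul0n !add0n addn1 addn2.
Qed.

Lemma C_bipartE n p l : C_bipart n p l = bipart true n p l.
Proof.
rewrite /C_bipart /bipart /C_excluded excludedE size_map size_rev (iotaDl 1 0)
  all_map.
congr [&& _, _, _ & _]; apply: eq_all => i /=.
have -> : asc_part p (1 + i) %/ 2 = nth 0 (map half (rev p)) i.
  rewrite /asc_part /= divn2; have [lt|ge] := ltnP i (size (rev p)).
    by rewrite (nth_map 0).
  by rewrite !nth_default ?size_map.
rewrite !mem_rev mul1n add0n; set x := nth _ _ _.
have -> : x + (1 + i) - 1 = i + x by lia.
have -> : x + (1 + i) = (i + x).+1 by lia.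
by rewrite addn1.
Qed.

(** Halving turns gaps of at least 4 between even parts into gaps of at least 2, and parts above 2
    into parts above 1. Parts above 1 are nonzero, which settles the positivity conditions. *)
Lemma bipart_rev e n h l : bipart e n (rev (map double h)) (rev l) =
  admissible e 0 1 false (h, l) && (weight (h, l) == n).
Proof.
rewrite /bipart /admissible /weight /= !revK -map_comp.
have -> : map (half \o double) h = h.
  by rewrite -[RHS]map_id; apply: eq_map => x /=; rewrite doubleK.
have -> : even_gap4 (rev (map double h)) = all (ltn 1) h && sorted gap2 h.
  rewrite /even_gap4 revK all_rev all_map sorted_map.
  congr (_ && _); first by apply: eq_all => x /=; rewrite odd_double /= -muln2;
    lia.
  by apply: eq_sorted => x y; rewrite /gap2 /= -!muln2; lia.
have -> : distinct_gt1 (rev l) = uniq l && all (ltn 1) l.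
  by rewrite /distinct_gt1 rev_uniq all_rev.
have sum2 q : sumn (map double q) = 2 * sumn q.
  by elim: q => [|x q /= ->]; rewrite ?muln0 // mulnDr !mul2n.
rewrite /is_bipartition_of /is_partition_of /is_partition /union_partition.
rewrite (perm_sumn (permEl (perm_sort _ _))) sumn_cat !sumn_rev sum2.
rewrite sort_sorted; last by move=> x y; apply: leq_total.
rewrite !rev_sorted !mem_rev mem_sort mem_cat !mem_rev ltn_sorted_uniq_leq /=.
have lt0 q : all (ltn 1) q -> 0 \notin q by move=> /notin_all_ltn; apply.
have gap_leq : sorted gap2 h -> sorted leq (map double h).
  rewrite sorted_map; apply: sub_sorted => x y.
  by rewrite /gap2 /= -!muln2; lia.
have dbl0 : (0 \in map double h) = (0 \in h).
  by rewrite -[RHS](mem_map double_inj).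
rewrite !dbl0.
case h1: (all (ltn 1) h); rewrite ?andbF //= (negbTE (lt0 _ h1)).
case h2: (sorted gap2 h); rewrite ?andbF //= (gap_leq h2).
case l1: (all (ltn 1) l); rewrite ?andbF //= (negbTE (lt0 _ l1)).
by rewrite !andbT /= -!andbA; do !bool_congr.
Qed.

Lemma card_bipart (e : bool) (Q : seq nat -> seq nat -> bool) n :
  (forall p l, Q p l = bipart e n p l) ->
  #|[set x : bparts n * bparts n | Q (parts x.1) (parts x.2)]|
  = count (fun x => weight x == n) (pairs e n.+1 0 1 false).
Proof.
move=> QE; rewrite -size_filter.
pose back (x : seq nat * seq nat) := (rev (map double x.1), rev x.2).
have back_inj : injective back.
  move=> [h l] [h' l'] [/(can_inj revK)/(inj_map double_inj) -> ].
  by move/(can_inj revK) ->.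
rewrite -(size_map back).
apply: (@card_size _ _ (fun x => (parts x.1, parts x.2))).
- by move=> [x y] [x' y'] [/parts_inj -> /parts_inj ->].
- by rewrite (map_inj_uniq back_inj) filter_uniq ?pairs_uniq.
move=> pl; split.
  case/mapP => -[h l]; rewrite mem_filter => /andP[w /pairs_sound a] ->.
  have b : bipart e n (rev (map double h)) (rev l) by rewrite bipart_rev a.
  have /and4P[/parts_of_bipartition[x [y [xh yl]]] _ _ _] := b.
  by exists (x, y); rewrite /= ?inE /= xh yl ?QE.
case=> -[x y]; rewrite inE QE => b' <-.
have b : bipart e n (parts x) (parts y) := b'.
have /and4P[_ /andP[ev _] _ _] := b.
(* All parts are even, so doubling undoes the halving. *)
have px : parts x = rev (map double (map half (rev (parts x)))).
  rewrite -map_comp -[LHS]revK; congr rev; rewrite -[LHS]map_id.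
  apply/eq_in_map => a; rewrite mem_rev => /(allP ev)/andP[+ _] /=.
  by move=> /even_halfK.
apply/mapP; exists (map half (rev (parts x)), rev (parts y)).
  rewrite px -[parts y]revK bipart_rev in b; case/andP: b => a w.
  rewrite mem_filter w andTb; apply: (pairs_complete a) => /=.
    by move: w; rewrite /weight /=; lia.
  by move: w; rewrite /weight /=; lia.
by rewrite /back /= -px revK.
Qed.

Theorem theorem8 (n : nat) (hn : 0 < n) : A n = B n /\ B n = C n.
Proof.
have natZ_inj (a b : nat) : (a%:R = b%:R :> int)%R -> a = b.
  by move/eqP; rewrite !Num.Theory.eqr_nat => /eqP.
rewrite A_count /B /C (card_bipart (B_bipartE n)) (card_bipart (C_bipartE n)).
(* The counts are the coefficients of X^n, which a congruence modulo X^(n+1) determines. *)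
split; apply: natZ_inj; rewrite -!coef_gf.
  exact: eqm_coef (rparts_pairsB n.+1) (ltnSn n).
apply/esym/(eqm_coef _ (ltnSn n)).
by apply: pairsC_pairsB; rewrite add1n.
Qed.
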